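(* Let $f\colon\mathbb{R}\to\mathbb{C}$ be a continuous-time signal in $L^2(\mathbb{R})$ with compact support. Let $\alpha_1,\alpha_2$ be two real numbers satisfying $\alpha_1-\alpha_2\neq\pi k$ for all integers $k$, and let $M\subset\mathbb{R}$ be an open neighbourhood of zero. Then $f$ can be uniquely recovered up to a rotation from its Fourier intensity $|\mathcal{F}[f]|$ and the interference measurements $$\left|\mathcal{F}\left[ f+\mathrm{e}^{\mathrm{i}\alpha_1}\,\mathrm{e}^{\mathrm{i}\mu\,\cdot}\,f\right]\right| \quad\text{and}\quad \left|\mathcal{F}\left[ f+\mathrm{e}^{\mathrm{i}\alpha_2}\,\mathrm{e}^{\mathrm{i}\mu\,\cdot}\,f\right]\right| \qquad (\mu\in M).$$ That is, if $g$ is a signal in $L^2(\mathbb{R})$ with compact support such that, for all $\omega\in\mathbb{R}$, $|\mathcal{F}[g](\omega)|=|\mathcal{F}[f](\omega)|$ and $\left|\mathcal{F}[ g+\mathrm{e}^{\mathrm{i}\alpha_j}\mathrm{e}^{\mathrm{i}\mu\,\cdot}g](\omega)\right|=\left|\mathcal{F}[ f+\mathrm{e}^{\mathrm{i}\alpha_j}\mathrm{e}^{\mathrm{i}\mu\,\cdot}f](\omega)\right|$ for $j=1,2$ and all $\mu\in M$, then there exists $\alpha\in\mathbb{R}$ with $g=\mathrm{e}^{\mathrm{i}\alpha}f$ almost everywhere.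
   Context: For $f\in L^2(\mathbb{R})$ with compact support, the Fourier transform is $\mathcal{F}[f](\omega)=\int_{-\infty}^{\infty} f(t)\,\mathrm{e}^{-\mathrm{i}\omega t}\,\mathrm{d}t$ for $\omega\in\mathbb{R}$, and $|\mathcal{F}[f]|$ is called the Fourier intensity. The modulated signal $\mathrm{e}^{\mathrm{i}\mu\,\cdot}f$ is the function $t\mapsto\mathrm{e}^{\mathrm{i}\mu t}f(t)$; its Fourier transform is $\mathcal{F}[f](\omega-\mu)$. A rotation of $f$ is the signal $\mathrm{e}^{\mathrm{i}\alpha}f$ with $\alpha\in\mathbb{R}$. *)

(* Defs.v *)
From HB Require Import structures.
From mathcomp Require Import all_boot all_order all_algebra.
From mathcomp Require Import all_classical all_reals all_analysis.
From mathcomp Require Import complex.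

Set Implicit Arguments.
Unset Strict Implicit.
Unset Printing Implicit Defensive.

Import Order.TTheory GRing.Theory Num.Theory.
Import numFieldNormedType.Exports.

Local Open Scope classical_set_scope.
Local Open Scope ring_scope.
Local Open Scope complex_scope.

(* exp(i x), by Euler's formula *)
Definition expi (R : realType) (x : R) : R[i] := cos x +i* sin x.

(* [Rintegral] is 0 when the extended-real integral is infinite, so this is the
   Lebesgue integral whenever both parts of [h] are integrable; this covers
   every use below, since compactly supported L^2 functions are in L^1. *)
Definition cintegral (R : realType) (h : R -> R[i]) : R[i] :=
  Rintegral (@lebesgue_measure R) setT (fun t => complex.Re (h t)) +i*
  Rintegral (@lebesgue_measure R) setT (fun t => complex.Im (h t)).

Definition fourier (R : realType) (f : R -> R[i]) (w : R) : R[i] :=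
  cintegral (fun t => f t * expi (- (w * t))).

Definition modulate (R : realType) (mu : R) (f : R -> R[i]) : R -> R[i] :=
  fun t => expi (mu * t) * f t.

(* Membership of (a Borel representative) f in L^2(R; C).  [normc z] is the
   modulus of z as an element of R, whereas [`|z|] lives in R[i]. *)
Definition square_integrable (R : realType) (f : R -> R[i]) : Prop :=
  [/\ measurable_fun setT (fun t : R => complex.Re (f t)),
      measurable_fun setT (fun t : R => complex.Im (f t)) &
      finite_norm (@lebesgue_measure R) 2%:E
        (fun t => ComplexField.Normc.normc (f t))].

(* Elements of L^2 are classes modulo a.e. equality, so the support is the
   essential one. *)
Definition compactly_supported (R : realType) (f : R -> R[i]) : Prop :=
  exists2 K : set R, compact K &
    {ae (@lebesgue_measure R), forall t, ~ K t -> f t = 0}.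

(* Main.v *)
Require Import Defs.
From HB Require Import structures.
From mathcomp Require Import all_boot all_order all_algebra.
From mathcomp Require Import all_classical all_reals all_analysis.
From mathcomp Require Import complex.
From mathcomp Require Import measurable_realfun ring lra.

(** Write F and G for the Fourier transforms of f and g.  Expanding the square
    of an interference gives
      |F(w) + e^(ia) F(w-m)|^2
        = |F(w)|^2 + |F(w-m)|^2 + 2 Re (e^(ia) conj(F(w)) F(w-m)),
    so each of the two interferences yields one real linear equation for the
    number conj(F(w)) F(w-m).  The two equations are independent because
    sin(alpha1 - alpha2) is not zero, hence the data determine the correlation:
      conj(G(w)) G(w-m) = conj(F(w)) F(w-m)  for all w and all m in M
    ([interference_product]).  If F vanishes identically, so does G.  Otherwise
    fix w0 with F(w0) != 0.  Then
    G(w0) = e^(ia) F(w0) for some real a since |G| = |F|, and the correlation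
    at w0 transports this phase to a neighbourhood: G = e^(ia) F near w0.

    It remains to see that an integrable h with compact support is zero almost
    everywhere as soon as its transform vanishes on an interval
    ([fourier_local_uniqueness], applied to h = g - e^(ia) f).  Classically
    this combines the analyticity of the transform with Fourier inversion.
    Here both are replaced by one argument on moments.  After a modulation the
    interval is centred at 0, and the real and imaginary parts u of h satisfy
      int u(t) cos(w t + theta) dt = 0  for |w| < d and all theta.
    Differentiating in w shows that t u(t) has the same property
    ([band_null_mul_id]); hence so does p(t) u(t) for every polynomial p, and
    at w = theta = 0 all polynomial moments of u vanish.  The polynomials
    (1 - s^n)^(2^n), with s an affine function of t that maps the support into
    [0, 1] and x to 1/2, are bounded by 1 and converge to the indicator of
    t < x off the point x.  By dominated convergence the integral of u over
    ]-oo, x] is zero for every x ([invisible_integral_itv]), and Lebesgue's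
    differentiation theorem gives u = 0 almost everywhere. *)

Set Implicit Arguments.
Unset Strict Implicit.
Unset Printing Implicit Defensive.

Import Order.TTheory GRing.Theory Num.Theory.
Import numFieldNormedType.Exports.

Local Open Scope classical_set_scope.
Local Open Scope ring_scope.
Local Open Scope complex_scope.

#[local] Instance ae_lebesgue_filter (R : realType) :
  Filter (nbhs (almost_everywhere (@lebesgue_measure R))).
Proof. exact: ae_filter_ringOfSetsType. Qed.

(** * Moments of a function with no Fourier content near frequency zero *)

Section BandNull.
Context {R : realType}.
Notation mu := (@lebesgue_measure R).
Implicit Types (u h : R -> R) (B d x : R).

(** Keeping an arbitrary phase theta treats cosine and sine at once, and makes
    the property stable under differentiation in w, which shifts the phase by
    a quarter turn. *)
Definition band_null d u := forall w theta, `|w| < d ->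
  \int[mu]_t (u t * cos (w * t + theta)) = 0.

Definition integrable_within B u :=
  mu.-integrable setT (EFin \o u) /\ forall t, B < `|t| -> u t = 0.

Lemma measurable_cos_affine w theta :
  measurable_fun setT (fun t : R => cos (w * t + theta)).
Proof.
apply: continuous_measurable_fun => t.
apply: continuous_comp; last exact: continuous_cos.
apply: continuousD; last exact: cvg_cst.
by apply: continuousM => //; exact: cvg_cst.
Qed.

Lemma integrableM_bounded u h (C : R) : mu.-integrable setT (EFin \o u) ->
  measurable_fun setT h -> (forall t, `|h t| <= C) ->
  mu.-integrable setT (EFin \o (fun t => u t * h t)).
Proof.
move=> iu mh hC; have := @integrableMl _ _ _ mu setT measurableT _ h iu mh.
apply; exists C; split; first exact: num_real.
by move=> y Cy t _; exact: le_trans (hC t) (ltW Cy).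
Qed.

Lemma integrableM_cos u w theta : mu.-integrable setT (EFin \o u) ->
  mu.-integrable setT (EFin \o (fun t => u t * cos (w * t + theta))).
Proof.
move=> iu; apply: (@integrableM_bounded _ _ 1) => // [|t]; last exact: cos_max.
exact: measurable_cos_affine.
Qed.

Lemma integrable_withinM B u h (C : R) : integrable_within B u ->
  measurable_fun setT h -> (forall t, `|t| <= B -> `|h t| <= C) ->
  integrable_within B (fun t => h t * u t).
Proof.
move=> [iu u0] mh hC; split; last by move=> t /u0 ->; rewrite mulr0.
pose D := `[- B, B]%classic.
have mD : measurable D by exact: measurable_itv.
have D_E t : (t \in D) = (`|t| <= B) by rewrite ler_norml /D mem_setE in_itv.
have -> : (fun t => h t * u t) = (fun t => u t * (h \_ D) t).
  apply/funext => t; rewrite patchE D_E; have [|/u0->] := leP `|t| B.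
    by rewrite mulrC.
  by rewrite mulr0 mul0r.
apply: (@integrableM_bounded _ _ `|C|) => //.
  by apply/(measurable_restrictT _ mD); exact: measurable_funTS.
move=> t; rewrite patchE D_E; case: ifPn => [/hC/le_trans->//|_].
  exact: ler_norm.
by rewrite normr0.
Qed.

(** Differentiation under the integral sign: the w-derivative of
    int u(t) cos(w t + theta - pi/2) dt, which is locally zero, is
    int t u(t) cos(w t + theta) dt.  The bounded support provides the dominating
    function. *)
Lemma band_null_mul_id B d u : integrable_within B u -> band_null d u ->
  band_null d (fun t => t * u t).
Proof.
move=> [iu u0] nu w theta wd.
pose f x t := u t * cos (x * t + (theta - pi / 2)).
have df x t : is_derive x 1 (f ^~ t) (t * u t * cos (x * t + theta)).
  rewrite /f; apply: is_derive_eq.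
  by rewrite addrA sinBpihalf /GRing.scale/=; ring.
have d1f x t : partial1of2 f x t = t * u t * cos (x * t + theta).
  by rewrite partial1of2E derive_val.
have wI : w \in `]- d, d[ by rewrite in_itv/= -ltr_norml.
have G0 t : 0 <= `|B| * `|u t| by rewrite mulr_ge0.
have iG : mu.-integrable setT (EFin \o (fun t => `|B| * `|u t|)).
  exact: (integrableZl measurableT `|B| (integrable_norm iu)).
have Gub x t : `]-d, d[%classic x -> setT t ->
    `|partial1of2 f x t| <= `|B| * `|u t|.
  move=> _ _; rewrite d1f !normrM.
  have [tB|/u0->] := leP `|t| B; last by rewrite normr0 mulr0 mul0r mulr0.
  rewrite -[leRHS]mulr1 ler_pM ?cos_max// ler_wpM2r//.
  by rewrite (le_trans tB)// ler_norm.
have derf x y : `]-d, d[%classic x -> setT y -> derivable (f ^~ y) x 1.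
  by move=> _ _; exact: ex_derive.
have intf x : `]-d, d[%classic x -> mu.-integrable setT (EFin \o f x).
  by move=> _; exact: integrableM_cos.
have dF : 'D_1 (fun x => \int[mu]_y f x y) w = 0.
  rewrite (_ : 0 = 'D_1 (cst 0 : R -> R) w); last by rewrite derive_cst.
  apply: near_eq_derive.
  near=> x; apply: nu; rewrite ltr_norml.
  suff : x \in `]-d, d[ by rewrite in_itv.
  by near: x; exact: near_in_itvoo.
rewrite -[RHS]dF -derive1E.
rewrite (differentiation_under_integral measurableT wI intf derf G0 iG Gub).
by apply: eq_Rintegral => t _; rewrite d1f.
Unshelve. all: by end_near.
Qed.

(** The class of functions on which multiplication by polynomials acts: the
    support condition makes every moment converge. *)
Definition invisible B d u := integrable_within B u /\ band_null d u.

Lemma invisibleB B d u v : invisible B d u -> invisible B d v ->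
  invisible B d (fun t => u t - v t).
Proof.
move=> [[iu u0] nu] [[iv v0] nv]; split; first split.
- exact: (integrableB measurableT iu iv).
- by move=> t Bt; rewrite u0// v0// subrr.
- move=> w theta wd; under eq_Rintegral do rewrite mulrBl.
  rewrite RintegralB// ?nu ?nv ?subrr//; exact: integrableM_cos.
Qed.

Lemma invisibleZ B d c u : invisible B d u -> invisible B d (fun t => c * u t).
Proof.
move=> [[iu u0] nu]; split; first split.
- exact: (integrableZl measurableT c iu).
- by move=> t Bt; rewrite u0// mulr0.
- move=> w theta wd; under eq_Rintegral do rewrite -mulrA.
  rewrite RintegralZl// ?nu ?mulr0//; exact: integrableM_cos.
Qed.

Lemma invisible_mul_id B d u :
  invisible B d u -> invisible B d (fun t => t * u t).
Proof.
move=> [iu nu]; split; last exact: band_null_mul_id iu nu.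
by apply: (@integrable_withinM _ _ id B) => //; exact: measurable_id.
Qed.

Lemma invisible_affineX B d (a b : R) n u : invisible B d u ->
  invisible B d (fun t => (a * t + b) ^+ n * u t).
Proof.
move=> nu; elim: n => [|n ih].
  by rewrite (_ : (fun _ => _) = u)//; apply/funext => t; rewrite mul1r.
have := invisibleB (invisibleZ a (invisible_mul_id ih)) (invisibleZ (- b) ih).
by congr invisible; apply/funext => t; rewrite exprS; ring.
Qed.

Lemma invisible_steep B d (a b : R) n m u : invisible B d u ->
  invisible B d (fun t => (1 - (a * t + b) ^+ n) ^+ m * u t).
Proof.
move=> nu; elim: m => [|m ih].
  by rewrite (_ : (fun _ => _) = u)//; apply/funext => t; rewrite mul1r.
have := invisibleB ih (invisible_affineX a b n ih).
by congr invisible; apply/funext => t; rewrite exprS; ring.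
Qed.

Lemma Rintegral_invisible B d u : 0 < d -> invisible B d u ->
  \int[mu]_t u t = 0.
Proof.
move=> d0 [_ /(_ 0 0)]; rewrite normr0 => /(_ d0) <-.
by apply: eq_Rintegral => t _; rewrite mul0r addr0 cos0 mulr1.
Qed.

(** * Polynomials that approximate a step function *)

Lemma bernoulli_ineq (y : R) n : -1 <= y -> 1 + n%:R * y <= (1 + y) ^+ n.
Proof.
move=> y1; elim: n => [|n ih]; first by rewrite mul0r addr0.
have n0 : 0 <= n%:R :> R by [].
rewrite exprS -natr1; apply: (le_trans _ (ler_wpM2l _ ih)); last lra.
by have := sqr_ge0 y; nra.
Qed.

(** For s in [0, 1] the powers s^n and 2^n compete: s^n is negligible against
    2^-n below s = 1/2 and dominates it above, which makes these polynomials
    tend to a step function. *)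
Definition steep n (s : R) := (1 - s ^+ n) ^+ (2 ^ n).

Lemma steep_itv n (s : R) : 0 <= s <= 1 -> 0 <= steep n s <= 1.
Proof.
move=> /andP[s0 s1]; have := exprn_ge0 n s0; have := exprn_ile1 n s0 s1.
by move=> ? ?; rewrite /steep exprn_ge0 ?exprn_ile1//; lra.
Qed.

(** Bernoulli's inequality bounds 1 - steep n s by 2^n s^n. *)
Lemma steep_cvg1 (s : R) : 0 <= s < 2^-1 -> steep n s @[n --> \oo] --> (1 : R).
Proof.
move=> /andP[s0 s1].
have lo n : 1 - (2 * s) ^+ n <= steep n s.
  have sn1 : s ^+ n <= 1 by apply: exprn_ile1 => //; lra.
  have := @bernoulli_ineq (- s ^+ n) (2 ^ n).
  by rewrite natrX exprMn mulrN; apply; lra.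
apply: (@squeeze_cvgr _ _ _ _ (fun n => 1 - (2 * s) ^+ n) (cst 1)).
- near=> n; rewrite lo/=.
  by have /(steep_itv n)/andP[] : 0 <= s <= 1 by lra.
- rewrite -[X in _ --> X]subr0; apply: cvgB; first exact: cvg_cst.
  by apply: cvg_expr; rewrite ger0_norm; lra.
- exact: cvg_cst.
Unshelve. all: by end_near.
Qed.

(** Multiplying by (1 + s^n)^(2^n) >= (2s)^n gives (1 - s^(2n))^(2^n) <= 1, so
    steep n s is at most (2s)^-n. *)
Lemma steep_cvg0 (s : R) : 2^-1 < s <= 1 -> steep n s @[n --> \oo] --> (0 : R).
Proof.
move=> /andP[s0 s1].
have hi n : steep n s <= (2 * s)^-1 ^+ n.
  have sn1 : s ^+ n <= 1 by apply: exprn_ile1 => //; lra.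
  have sn0 : 0 < s ^+ n by rewrite exprn_gt0//; lra.
  rewrite exprVn -[leRHS]mul1r ler_pdivlMr; last by rewrite exprn_gt0//; lra.
  have [q0 _] : 0 <= steep n s /\ True.
    by split=> //; have /(steep_itv n)/andP[] : 0 <= s <= 1 by lra.
  apply: (@le_trans _ _ (steep n s * (1 + s ^+ n) ^+ (2 ^ n))).
    apply: ler_wpM2l => //.
    have := @bernoulli_ineq (s ^+ n) (2 ^ n).
    by rewrite natrX exprMn; lra.
  rewrite /steep -exprMn exprn_ile1//; nra.
apply: (@squeeze_cvgr _ _ _ _ (cst 0) (fun n => (2 * s)^-1 ^+ n)).
- near=> n; rewrite hi/= andbT.
  by have /(steep_itv n)/andP[] : 0 <= s <= 1 by lra.
- exact: cvg_cst.
- apply: cvg_expr; rewrite ger0_norm ?invr_ge0 ?invf_lt1; lra.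
Unshelve. all: by end_near.
Qed.

(** * Vanishing of invisible functions *)

(** Invisibility is preserved by polynomial factors, so u has zero integral
    against every polynomial; the step functions at x are bounded limits of
    polynomials on the support. *)
Lemma invisible_integral_itv B d u x : 0 < d -> invisible B d u ->
  \int[mu]_(t in `]-oo, x]) u t = 0.
Proof.
move=> d0 nu; have [[iu u0] _] := nu.
(* The slope c keeps the affine map s within [0, 1] on [-B, B]; s x = 1/2. *)
pose c : R := (2 * (`|B| + `|x| + 1))^-1.
have C0 : 0 < `|B| + `|x| + 1 :> R.
  by have := normr_ge0 B; have := normr_ge0 x; lra.
have c0 : 0 < c by rewrite invr_gt0; lra.
pose s (t : R) : R := c * t + (2^-1 - c * x).
have sE t : s t = 2^-1 + c * (t - x) by rewrite /s; ring.
have s01 t : `|t| <= B -> 0 <= s t <= 1.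
  move=> tB; have : `|c * (t - x)| <= 2^-1.
    rewrite normrM (gtr0_norm c0) /c invfM -mulrA ler_piMr// mulrC.
    rewrite ler_pdivrMr// mul1r (le_trans (ler_normB _ _))//.
    by have := ler_norm B; lra.
  by rewrite ler_norml sE => /andP[]; lra.
pose v n (t : R) : \bar R := (steep n (s t) * u t)%:E.
have nv n : invisible B d (fun t => steep n (s t) * u t).
  exact: invisible_steep.
have mv n : measurable_fun [set: R] (v n).
  by have [[/measurable_int]] := nv n.
have mu_x : measurable_fun [set: R] (fun t => ((u \_ `]-oo, x]) t)%:E).
  apply/measurable_EFinP; apply/(measurable_restrictT _ (measurable_itv _)).
  apply: measurable_funTS; apply/measurable_EFinP.
  exact: (measurable_int mu iu).
have lim_v : {ae mu, forall t, setT t ->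
    v ^~ t @ \oo --> ((u \_ `]-oo, x]) t)%:E}.
  (* At t = x the sequence tends to u(x)/e, but one point is negligible. *)
  exists [set x]; split; rewrite ?lebesgue_measure_set1//.
  move=> t /= /not_implyP[_]; apply: contra_notP => tx.
  apply: cvg_EFin; first exact: nearW.
  rewrite patchE mem_setE in_itv/=.
  have [/s01/andP[s0 s1]|/u0 ut] := leP `|t| B; last first.
    rewrite /v ut if_same; under eq_fun do rewrite mulr0; exact: cvg_cst.
  rewrite /v; case: ifPn => [t_x|]; last rewrite -ltNge => x_t.
    rewrite -[X in _ --> X]mul1r; apply: cvgMr_tmp; apply: steep_cvg1.
    rewrite s0 sE; have : t < x by rewrite lt_neqAle t_x andbT; exact/eqP.
    by move=> ?; nra.
  rewrite -[X in _ --> X](mul0r (u t)); apply: cvgMr_tmp; apply: steep_cvg0.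
  by rewrite s1 sE; nra.
have bnd_v : {ae mu, forall t n, setT t -> (`|v n t| <= `|u t|%:E)%E}.
  apply: aeW => t n _; rewrite lee_fin normrM.
  have [/s01/(steep_itv n)/andP[q0 q1]|/u0->] := leP `|t| B.
    by rewrite ger0_norm// ler_piMl.
  by rewrite normr0 mulr0.
have [_ _] := @dominated_convergence _ _ _ mu _ measurableT _ _ _ mv mu_x lim_v
  (integrable_norm iu) bnd_v.
have v0 n : (\int[mu]_t (v n t) = 0)%E.
  have [[iv _] _] := nv n.
  rewrite -[LHS]fineK; last exact: integrable_fin_num iv.
  by congr EFin; exact: Rintegral_invisible d0 (nv n).
rewrite /= (_ : (fun _ => _) = cst 0%E); last by apply/funext => n; exact: v0.
move=> /cvg_lim vlim; rewrite Rintegral_mkcond.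
transitivity (fine (lim ((cst 0 : nat -> \bar R) @ \oo)%E)).
  by rewrite vlim.
by rewrite lim_cst.
Qed.

Lemma ae_eq0_of_integral_itv u : mu.-integrable setT (EFin \o u) ->
  (forall x, \int[mu]_(t in `]-oo, x]) u t = 0) ->
  {ae mu, forall t, u t = 0}.
Proof.
move=> iu u0.
have iuN y : mu.-integrable `]-oo, y] (EFin \o u).
  exact: integrableS iu.
have := FTC1Ny iuN (open_integrable_locally openT iu).
apply: filterS => x [_ <-].
rewrite (_ : (fun _ => _) = cst 0); last exact/funext.
by rewrite derive1_cst.
Qed.

(** The previous results need u to vanish everywhere outside an interval; an
    almost everywhere hypothesis reduces to this by truncating u. *)
Lemma band_null_ae0 B d u : 0 < d -> mu.-integrable setT (EFin \o u) ->
  {ae mu, forall t, B < `|t| -> u t = 0} -> band_null d u ->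
  {ae mu, forall t, u t = 0}.
Proof.
move=> d0 iu suppu nu.
pose D := `[- B, B]%classic.
have mD : measurable D by exact: measurable_itv.
have D_E t : (t \in D) = (`|t| <= B) by rewrite ler_norml /D mem_setE in_itv.
have uD : {ae mu, forall t, u t = (u \_ D) t}.
  apply: filterS suppu => t ut; rewrite patchE D_E.
  by case: leP => // /ut.
have iuD : mu.-integrable setT (EFin \o (u \_ D)).
  rewrite -restrict_EFin.
  apply: ((@integrable_mkcond _ _ _ mu D (EFin \o u) mD).1 _).
  exact: integrableS iu.
have nuD : invisible B d (u \_ D).
  split; first split => // t.
    by rewrite patchE D_E ltNge => /negbTE ->.
  move=> w theta /(nu _ theta) <-; congr fine; apply: ae_eq_integral => //.
  - exact: measurable_int (integrableM_cos _ _ iuD).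
  - exact: measurable_int (integrableM_cos _ _ iu).
  - by apply: filterS uD => t -> _.
have := ae_eq0_of_integral_itv iuD (fun x => invisible_integral_itv x d0 nuD).
by apply: filterS2 uD => t ->.
Qed.

End BandNull.

(** * Phases and interferences of complex numbers *)

Section Expi.
Context {R : realType}.
Implicit Types (a x y : R) (z : R[i]).

Lemma expiD x y : expi (x + y) = expi x * expi y.
Proof. by rewrite /expi cosD sinD; simpc; congr (_ +i* _); ring. Qed.

Lemma expi0 : expi (0 : R) = 1.
Proof. by rewrite /expi cos0 sin0. Qed.

Lemma norm_eq1_expi z : `|z| = 1 -> exists a, z = expi a.
Proof.
move=> /(congr1 (fun z => z ^+ 2)); rewrite -add_Re2_Im2 expr1n.
move=> /complexI.
case: z => p q /= pq1.
have p1 : -1 <= p <= 1.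
  rewrite -ler_norml -(@ler_pXn2r _ 2)// ?nnegrE//.
  rewrite expr1n real_normK ?num_real//.
  by have := sqr_ge0 q; lra.
have sq : sin (acos p) = `|q|.
  by rewrite sin_acos// -sqrtr_sqr; congr Num.sqrt; lra.
have cp : cos (acos p) = p by rewrite acosK.
have [q0|q0] := leP 0 q.
  by exists (acos p); rewrite /expi cp sq ger0_norm.
by exists (- acos p); rewrite /expi cosN sinN cp sq ltr0_norm// opprK.
Qed.

Lemma sin_eq0_pi x : sin x = 0 -> exists k : int, x = pi * k%:~R.
Proof.
move=> sx0; have pi0 := @pi_gt0 R.
pose k := Num.floor (x / pi); exists k.
have sink (m : nat) : sin (pi *+ m) = 0 :> R.
  by rewrite -[pi *+ m]add0r (alternatingn (@sinDpi R)) sin0 mulr0.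
have {}sink : sin (pi * k%:~R) = 0 :> R.
  case: k => m; rewrite ?NegzE ?mulrNz ?mulrN ?sinN -pmulrn mulr_natr;
    by rewrite sink ?oppr0.
have sr : sin (x - pi * k%:~R) = 0 by rewrite sinB sx0 sink mul0r mulr0 subr0.
have /andP[] := floor_itv (x / pi).
rewrite -/k ler_pdivlMr// ltr_pdivrMr// intrD mulrDl mul1r [_ * pi]mulrC.
move=> kx xk; apply/eqP; rewrite -subr_eq0; apply: contraT => r0.
suff : 0 < sin (x - pi * k%:~R) by rewrite sr ltxx.
apply: sin_gt0_pi; rewrite lt_neqAle eq_sym r0/=; lra.
Qed.

Lemma sqr_norm_interference a z1 z2 :
  `|z1 + expi a * z2| ^+ 2 = `|z1| ^+ 2 + `|z2| ^+ 2 +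
    (2 * complex.Re (expi a * (z1^*%C * z2)))%:C.
Proof.
rewrite -!add_Re2_Im2 -!rmorphD; congr (_ %:C).
case: z1 z2 => [p1 q1] [p2 q2]; rewrite /expi; simpc => /=.
have := cos2Dsin2 a; move: (cos a) (sin a) => c s cs1.
have -> : p2 ^+ 2 + q2 ^+ 2 = (c ^+ 2 + s ^+ 2) * (p2 ^+ 2 + q2 ^+ 2).
  by rewrite cs1 mul1r.
ring.
Qed.

(** The real parts of e^(i a1) z and e^(i a2) z are two linear forms in the
    coordinates of z, with determinant sin(a1 - a2). *)
Lemma Re_expi_eq0 a1 a2 z : (forall k : int, a1 - a2 <> pi * k%:~R) ->
  complex.Re (expi a1 * z) = 0 -> complex.Re (expi a2 * z) = 0 -> z = 0.
Proof.
move=> a12; case: z => x y; rewrite /expi; simpc => /= e1 e2.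
have D0 : sin (a1 - a2) != 0 by apply/eqP => /sin_eq0_pi[k]; exact: a12.
have x0 : x = 0.
  apply: (mulfI D0); rewrite mulr0 sinB.
  transitivity (sin a1 * (cos a2 * x - sin a2 * y) -
                sin a2 * (cos a1 * x - sin a1 * y)); first by ring.
  by rewrite e1 e2 !mulr0 subrr.
have y0 : y = 0.
  apply: (mulfI D0); rewrite mulr0 sinB.
  transitivity (cos a1 * (cos a2 * x - sin a2 * y) -
                cos a2 * (cos a1 * x - sin a1 * y)); first by ring.
  by rewrite e1 e2 !mulr0 subrr.
by rewrite x0 y0.
Qed.

(** Polarization: two interferences with independent phases determine both
    coordinates of the product, where one would leave a line of candidates. *)
Lemma interference_product a1 a2 z1 z2 z1' z2' :
  (forall k : int, a1 - a2 <> pi * k%:~R) ->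
  `|z1| = `|z1'| -> `|z2| = `|z2'| ->
  `|z1 + expi a1 * z2| = `|z1' + expi a1 * z2'| ->
  `|z1 + expi a2 * z2| = `|z1' + expi a2 * z2'| ->
  z1^*%C * z2 = z1'^*%C * z2'.
Proof.
move=> a12 n1 n2 i1 i2.
have re a : `|z1 + expi a * z2| = `|z1' + expi a * z2'| ->
    complex.Re (expi a * (z1^*%C * z2 - z1'^*%C * z2')) = 0.
  move=> /(congr1 (fun z => z ^+ 2)); rewrite !sqr_norm_interference n1 n2.
  have two0 : 2 != 0 :> R by rewrite pnatr_eq0.
  move=> /addrI/complexI/(mulfI two0) e.
  have ReB (u v : R[i]) : complex.Re (u - v) = complex.Re u - complex.Re v.
    by case: u v => ? ? [].
  by rewrite mulrBr ReB e subrr.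
apply/eqP; rewrite -subr_eq0; apply/eqP.
by apply: Re_expi_eq0 a12 _ _; exact: re.
Qed.
End Expi.

(** * Fourier transforms of integrable complex functions *)

Section Fourier.
Context {R : realType}.
Notation mu := (@lebesgue_measure R).
Implicit Types (f g h : R -> R[i]) (B d w : R) (c z : R[i]).

Definition cintegrable h :=
  mu.-integrable setT (EFin \o (fun t => complex.Re (h t))) /\
  mu.-integrable setT (EFin \o (fun t => complex.Im (h t))).

Lemma cintegrableD f g : cintegrable f -> cintegrable g ->
  cintegrable (fun t => f t + g t).
Proof.
move=> [fr fi] [gr gi]; split.
- have := integrableD measurableT fr gr; congr (_.-integrable _ _).
  by apply/funext => t /=; case: (f t) (g t) => ? ? [].
- have := integrableD measurableT fi gi; congr (_.-integrable _ _).
  by apply/funext => t /=; case: (f t) (g t) => ? ? [].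
Qed.

Lemma cintegralD f g : cintegrable f -> cintegrable g ->
  cintegral (fun t => f t + g t) = cintegral f + cintegral g.
Proof.
move=> [fr fi] [gr gi]; rewrite /cintegral; simpc; rewrite -!RintegralD//.
by congr (_ +i* _); apply: eq_Rintegral => t _; case: (f t) (g t) => ? ? [].
Qed.

Lemma cintegrableZ c f : cintegrable f -> cintegrable (fun t => c * f t).
Proof.
case: c => x y [fr fi]; split.
- have := integrableB measurableT (integrableZl measurableT x fr)
    (integrableZl measurableT y fi); congr (_.-integrable _ _).
  by apply/funext => t /=; case: (f t).
- have := integrableD measurableT (integrableZl measurableT x fi)
    (integrableZl measurableT y fr); congr (_.-integrable _ _).
  by apply/funext => t /=; case: (f t).
Qed.

Lemma cintegralZ c f : cintegrable f ->
  cintegral (fun t => c * f t) = c * cintegral f.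
Proof.
case: c => x y [fr fi]; rewrite /cintegral; simpc.
rewrite -!RintegralZl// -?RintegralB -?RintegralD//.
- by congr (_ +i* _); apply: eq_Rintegral => t _; case: (f t).
- exact: (integrableZl measurableT x fi).
- exact: (integrableZl measurableT y fr).
- exact: (integrableZl measurableT x fr).
- exact: (integrableZl measurableT y fi).
Qed.

Lemma cintegrable_expi w f : cintegrable f ->
  cintegrable (fun t => f t * expi (- (w * t))).
Proof.
move=> [fr fi].
(* A sine is written as a cosine with phase pi/2. *)
have E t : f t * expi (- (w * t)) =
    (complex.Re (f t) * cos (w * t + 0) -
     complex.Im (f t) * cos (w * t + pi / 2)) +i*
    (complex.Re (f t) * cos (w * t + pi / 2) +
     complex.Im (f t) * cos (w * t + 0)).
  rewrite cosDpihalf addr0 /expi cosN sinN; case: (f t) => x y; simpc => /=.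
  by congr (_ +i* _); ring.
split.
- have := integrableB measurableT (integrableM_cos w 0 fr)
    (integrableM_cos w (pi / 2) fi); congr (_.-integrable _ _).
  by apply/funext => t /=; rewrite E.
- have := integrableD measurableT (integrableM_cos w (pi / 2) fr)
    (integrableM_cos w 0 fi); congr (_.-integrable _ _).
  by apply/funext => t /=; rewrite E.
Qed.

Lemma fourierD f g w : cintegrable f -> cintegrable g ->
  fourier (fun t => f t + g t) w = fourier f w + fourier g w.
Proof.
move=> cf cg; rewrite /fourier -cintegralD; [|exact: cintegrable_expi..].
by congr cintegral; apply/funext => t; rewrite mulrDl.
Qed.

Lemma fourierZ c f w : cintegrable f ->
  fourier (fun t => c * f t) w = c * fourier f w.
Proof.
move=> cf; rewrite /fourier -cintegralZ; last exact: cintegrable_expi.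
by congr cintegral; apply/funext => t; rewrite mulrA.
Qed.

Lemma fourier_modulate m f w : fourier (modulate m f) w = fourier f (w - m).
Proof.
congr cintegral; apply/funext => t; rewrite /modulate mulrAC mulrC -expiD.
by congr (_ * expi _); ring.
Qed.

(** The combination of the values at w and -w with coefficients e^(-i theta)/2
    and e^(i theta)/2 has the real kernel cos(w t + theta), and so separates the
    real and imaginary parts of h. *)
Lemma fourier_band_null d h : cintegrable h ->
  (forall w, `|w| < d -> fourier h w = 0) ->
  band_null d (fun t => complex.Re (h t)) /\
  band_null d (fun t => complex.Im (h t)).
Proof.
move=> ch h0.
suff cos0 w theta : `|w| < d ->
    cintegral (fun t => h t * (cos (w * t + theta))%:C) = 0.
  have e t w theta : h t * (cos (w * t + theta))%:C =
      (complex.Re (h t) * cos (w * t + theta)) +i*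
      (complex.Im (h t) * cos (w * t + theta)).
    by case: (h t) => x y; simpc.
  split=> w theta /(cos0 _ theta) [re im];
    [rewrite -[RHS]re|rewrite -[RHS]im];
    by apply: eq_Rintegral => t _; rewrite e.
move=> wd.
have c1 := cintegrableZ (expi (- theta)) (cintegrable_expi w ch).
have c2 := cintegrableZ (expi theta) (cintegrable_expi (- w) ch).
have : cintegral (fun t => 2^-1%:C *
    (expi (- theta) * (h t * expi (- (w * t))) +
     expi theta * (h t * expi (- (- w * t))))) = 0.
  rewrite cintegralZ; last exact: cintegrableD.
  rewrite cintegralD// !cintegralZ; [|exact: cintegrable_expi..].
  rewrite -[X in _ * (_ * X + _)]/(fourier h w).
  rewrite -[X in _ * (_ + _ * X)]/(fourier h (- w)).
  by rewrite !h0 ?normrN// !mulr0 addr0 mulr0.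
congr (_ = _); congr cintegral; apply/funext => t.
rewrite mulNr opprK ![expi _ * (_ * _)]mulrCA -!expiD -mulrDr.
rewrite mulrCA; congr (_ * _); rewrite -opprD [theta + _]addrC.
by rewrite /expi cosN sinN; simpc; congr (_ +i* _); field.
Qed.

(** A modulation moves w0 to the origin, where the moment argument applies to
    the real and imaginary parts. *)
Lemma fourier_local_uniqueness B d w0 h : 0 < d -> cintegrable h ->
  {ae mu, forall t, B < `|t| -> h t = 0} ->
  (forall w, `|w - w0| < d -> fourier h w = 0) ->
  {ae mu, forall t, h t = 0}.
Proof.
move=> d0 ch supph h0.
pose k t := h t * expi (- (w0 * t)).
have ck : cintegrable k by exact: cintegrable_expi.
have k0 w : `|w| < d -> fourier k w = 0.
  move=> wd; rewrite -(h0 (w + w0)); last by rewrite addrK.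
  congr cintegral; apply/funext => t; rewrite -mulrA -expiD.
  by congr (_ * expi _); ring.
have suppk : {ae mu, forall t, B < `|t| -> k t = 0}.
  by apply: filterS supph => t h0t /h0t; rewrite /k => ->; rewrite mul0r.
have [nr ni] := fourier_band_null ck k0; have [kr ki] := ck.
have re0 : {ae mu, forall t, complex.Re (k t) = 0}.
  apply: (band_null_ae0 d0 kr _ nr).
  by apply: filterS suppk => t k0t /k0t ->.
have im0 : {ae mu, forall t, complex.Im (k t) = 0}.
  apply: (band_null_ae0 d0 ki _ ni).
  by apply: filterS suppk => t k0t /k0t ->.
apply: filterS2 re0 im0 => t re im.
have : k t * expi (w0 * t) = 0.
  by case: (k t) re im => x y /= -> ->; rewrite mul0r.
by rewrite /k -mulrA -expiD addNr expi0 mulr1.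
Qed.

Lemma compactly_supported_bounded f : compactly_supported f ->
  exists B, {ae mu, forall t, B < `|t| -> f t = 0}.
Proof.
move=> [K /compact_bounded [M [_ MK]] f0]; exists (M + 1).
apply: filterS f0 => t f0 tM; apply: f0 => Kt.
have /= := MK (M + 1) _ t Kt; rewrite ltrDl ltr01 => /(_ isT).
by rewrite leNgt tM.
Qed.

(** On the bounded support, |Re f| and |Im f| are at most 1 + |f|^2. *)
Lemma L2_cintegrable f : square_integrable f -> compactly_supported f ->
  cintegrable f.
Proof.
move=> [mr mi f2] /compactly_supported_bounded[B suppf].
pose e t : R := complex.Re (f t) ^+ 2 + complex.Im (f t) ^+ 2.
have e0 t : 0 <= e t by rewrite addr_ge0 ?sqr_ge0.
have normE t : ComplexField.Normc.normc (f t) = Num.sqrt (e t).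
  by rewrite /e; case: (f t).
have me : measurable_fun [set: R] e.
  by apply: measurable_funD; exact: measurable_funX.
have ie : mu.-integrable setT (EFin \o e).
  have : (fun t => ComplexField.Normc.normc (f t)) \in Lfun mu 2%:E.
    rewrite inE; apply/andP; split; rewrite inE//=.
    rewrite (_ : (fun _ => _) = Num.sqrt \o e); last exact/funext.
    apply: measurableT_comp => //; apply: continuous_measurable_fun.
    exact: sqrt_continuous.
  move=> /Lfun2_integrable_sqr; congr (_.-integrable _ _).
  by apply/funext => t /=; rewrite normE sqr_sqrtr.
pose D := `[- B, B]%classic.
have mD : measurable D by exact: measurable_itv.
have D_E t : (t \in D) = (`|t| <= B) by rewrite ler_norml /D mem_setE in_itv.
have iD : mu.-integrable setT (EFin \o (\1_D : R -> R)).
  exact: integrable_indic_itv.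
have dom (p : R -> R) : measurable_fun setT p -> (forall t, p t ^+ 2 <= e t) ->
    {ae mu, forall t, B < `|t| -> p t = 0} ->
    mu.-integrable setT (EFin \o p).
  move=> mp pe suppp; apply/integrableP; split; first exact/measurable_EFinP.
  have iDe := integrableD measurableT iD ie.
  have /integrableP[_] := iDe; apply: le_lt_trans.
  apply: ae_ge0_le_integral => //.
  - by apply: measurableT_comp => //; exact/measurable_EFinP.
  - by apply: measurableT_comp => //; exact: measurable_int iDe.
  - apply: filterS suppp => t pt _; rewrite lee_fin/= indicE D_E.
    rewrite (ger0_norm (addr_ge0 _ (e0 t))) ?ler0n//.
    case: leP pt => [_ _|_ ->//]; last by rewrite normr0 add0r.
    have := pe t; rewrite -(real_normK (num_real (p t))).
    by rewrite mulr1n => pe2; have := sqr_ge0 (`|p t| - 1); nra.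
split; apply: dom => //.
- by move=> t; rewrite lerDl sqr_ge0.
- by apply: filterS suppf => t ft /ft ->.
- by move=> t; rewrite lerDr sqr_ge0.
- by apply: filterS suppf => t ft /ft ->.
Qed.

End Fourier.

(** * Phase retrieval *)

Theorem theorem3p11 (R : realType) (f : R -> R[i])
  (f_L2 : square_integrable f) (f_supp : compactly_supported f)
  (alpha1 alpha2 : R)
  (alpha12 : forall k : int, alpha1 - alpha2 <> pi * k%:~R)
  (M : set R) (M_open : open M) (M0 : M 0)
  (g : R -> R[i])
  (g_L2 : square_integrable g) (g_supp : compactly_supported g)
  (intensity : forall w : R, `|fourier g w| = `|fourier f w|)
  (interference1 : forall mu w : R, M mu ->
     `|fourier (fun t => g t + expi alpha1 * modulate mu g t) w| =
     `|fourier (fun t => f t + expi alpha1 * modulate mu f t) w|)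
  (interference2 : forall mu w : R, M mu ->
     `|fourier (fun t => g t + expi alpha2 * modulate mu g t) w| =
     `|fourier (fun t => f t + expi alpha2 * modulate mu f t) w|) :
  exists alpha : R,
    {ae (@lebesgue_measure R), forall t, g t = expi alpha * f t}.
Proof.
have cf := L2_cintegrable f_L2 f_supp.
have cg := L2_cintegrable g_L2 g_supp.
have interference a m w h : cintegrable h ->
    fourier (fun t => h t + expi a * modulate m h t) w =
    fourier h w + expi a * fourier h (w - m).
  move=> ch; have cm : cintegrable (modulate m h).
    have := cintegrable_expi (- m) ch; congr cintegrable.
    by apply/funext => t; rewrite mulNr opprK mulrC.
  by rewrite fourierD ?fourierZ ?fourier_modulate//; exact: cintegrableZ.
(* The modulated signal has transform [fourier f (w - m)], so the data are
   the intensities of two complex numbers and of their interferences. *)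
have correlation m w : M m ->
    (fourier g w)^*%C * fourier g (w - m) =
    (fourier f w)^*%C * fourier f (w - m).
  move=> Mm; apply: (interference_product alpha12) => //.
    by have := interference1 m w Mm; rewrite !interference.
  by have := interference2 m w Mm; rewrite !interference.
have [B suppB] : exists B, {ae @lebesgue_measure R, forall t, B < `|t| ->
    f t = 0 /\ g t = 0}.
  have [Bf f0] := compactly_supported_bounded f_supp.
  have [Bg g0] := compactly_supported_bounded g_supp.
  exists (Num.max Bf Bg); apply: filterS2 f0 g0 => t f0 g0.
  by rewrite gt_max => /andP[/f0 ? /g0].
have [d d0 dM] : exists2 d : R, 0 < d & forall m, `|m| < d -> M m.
  have /nbhs_ballP[d d0 dM] : nbhs (0 : R) M by exact: open_nbhs_nbhs.
  by exists d => // m md; apply: dM; rewrite /ball/= sub0r normrN.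
suff [w0 [alpha galpha]] : exists w0 alpha, forall w, `|w - w0| < d ->
    fourier g w = expi alpha * fourier f w.
  exists alpha.
  have cd : cintegrable (fun t => g t + - expi alpha * f t).
    by apply: cintegrableD => //; exact: cintegrableZ.
  have : {ae @lebesgue_measure R, forall t, g t + - expi alpha * f t = 0}.
    apply: (@fourier_local_uniqueness _ B d w0) => //.
      by apply: filterS suppB => t fg0 /fg0[-> ->]; rewrite mulr0 addr0.
    move=> w /galpha gw; rewrite fourierD ?fourierZ//; last exact: cintegrableZ.
    by rewrite gw mulNr subrr.
  by apply: filterS => t /eqP; rewrite mulNr subr_eq0 => /eqP.
(* If the transform of f vanishes identically then so does that of g, and any
   phase works. *)
have [[w0 /eqP fw0]|nof] := pselect (exists w0, fourier f w0 <> 0); last first.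
  exists 0, 0 => w _; have fw : fourier f w = 0.
    by apply: contrapT => fw; apply: nof; exists w.
  by have /eqP := intensity w; rewrite fw normr0 normr_eq0 mulr0 => /eqP.
(* The quotient of the two transforms at w0 has modulus one, and the
   correlation identity propagates this phase from w0 to all w near w0. *)
have gw0 : fourier g w0 != 0 by rewrite -normr_eq0 intensity normr_eq0.
have [alpha galpha] : exists alpha, fourier g w0 / fourier f w0 = expi alpha.
  by apply: norm_eq1_expi; rewrite normf_div intensity divff ?normr_eq0.
exists w0, alpha => w wd.
have /correlation : M (w0 - w) by apply: dM; rewrite distrC.
move=> /(_ w0); rewrite subKr => e.
have cgw0 : (fourier g w0)^*%C != 0 by rewrite conjc_eq0.
apply: (mulfI cgw0); rewrite e -galpha.
have : (fourier g w0)^*%C * fourier g w0 = (fourier f w0)^*%C * fourier f w0.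
  by have := correlation 0 w0 M0; rewrite subr0.
by move=> e0; rewrite mulrA mulrA e0; field.
Qed.
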